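(* For all positive integers $n$ and $k$, \[ \#\{\lambda\in\mathcal{SP}(n) : \lambda_1\ge k>\lambda_1-\lambda_{\ell(\lambda)},\ \ell(\lambda)\text{ odd}\} -\#\{\lambda\in\mathcal{SP}(n) : \lambda_1\ge k>\lambda_1-\lambda_{\ell(\lambda)},\ \ell(\lambda)\text{ even}\} =\begin{cases}1 & \text{if } k\mid n,\\ 0 & \text{if } k\nmid n.\end{cases} \]
   Context: A partition $\lambda$ of a positive integer $n$ is a sequence of integers $\lambda=(\lambda_1,\dots,\lambda_\ell)$ with $\lambda_1\ge\lambda_2\ge\cdots\ge\lambda_\ell>0$ and $\sum_i\lambda_i=n$; $\ell(\lambda):=\ell$ is its length. A partition is strict if $\lambda_1>\lambda_2>\cdots>\lambda_\ell>0$. $\mathcal{SP}(n)$ denotes the set of strict partitions of $n$. *)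

(* Defs.v *)
From HB Require Import structures.
From mathcomp Require Import all_boot all_order all_algebra.

Set Implicit Arguments.
Unset Strict Implicit.
Unset Printing Implicit Defensive.

Definition is_partition (n : nat) (s : seq nat) : bool :=
  [&& sorted geq s, 0 \notin s & sumn s == n].

Definition is_strict_partition (n : nat) (s : seq nat) : bool :=
  is_partition n s && sorted gtn s.

Record strict_partition (n : nat) := StrictPartition {
  parts :> seq nat;
  _ : is_strict_partition n parts
}.

HB.instance Definition _ (n : nat) := [isSub for @parts n].
HB.instance Definition _ (n : nat) := [Countable of strict_partition n by <:].

(* A partition of n has at most n parts, each at most n, so it can
   be encoded as a bounded sequence over 'I_n.+1. *)
Lemma leq_sumn_mem (s : seq nat) (i : nat) : i \in s -> i <= sumn s.
Proof.
elim: s => //= a s IHs; rewrite inE => /orP[/eqP->|/IHs]; first exact: leq_addr.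
by move/leq_trans; apply; exact: leq_addl.
Qed.

Lemma size_leq_sumn (s : seq nat) : 0 \notin s -> size s <= sumn s.
Proof.
elim: s => //= a s IHs; rewrite inE negb_or eq_sym -lt0n => /andP[a0 /IHs ls].
by rewrite -add1n leq_add.
Qed.

Definition bseq_of_strict_partition (n : nat) (la : strict_partition n) :
  n.-bseq 'I_n.+1 := insub_bseq n [seq inord i | i <- la].

Definition strict_partition_of_bseq (n : nat) (b : n.-bseq 'I_n.+1) :
  option (strict_partition n) := insub [seq val i | i <- b].

Lemma bseq_of_strict_partitionK (n : nat) :
  pcancel (@bseq_of_strict_partition n) (@strict_partition_of_bseq n).
Proof.
move=> la; rewrite /strict_partition_of_bseq.
suff -> : [seq val i | i <- bseq_of_strict_partition la] = val la by rewrite valK.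
have /andP[/and3P[_ la0 /eqP sla] _] := valP la.
rewrite /bseq_of_strict_partition /insub_bseq insubdK /=; last first.
  by rewrite -topredE /= size_map -[X in _ <= X]sla size_leq_sumn.
rewrite -map_comp -[RHS]map_id; apply/eq_in_map => i ila /=.
by rewrite inordK // ltnS -[X in _ <= X]sla leq_sumn_mem.
Qed.

HB.instance Definition _ (n : nat) : isFinite (strict_partition n) :=
  PCanIsFinite (@bseq_of_strict_partitionK n).

Notation "''SP' ( n )" := (strict_partition n)
  (at level 8, n at level 2, format "''SP' ( n )") : type_scope.

Definition largest_part (s : seq nat) : nat := head 0 s.
Definition smallest_part (s : seq nat) : nat := last 0 s.

Notation "'\ell' la" := (size (parts la)) (at level 10, la at level 8).

(* Main.v *)
(** Since [largest - smallest < k], the parts of [la] have distinct residues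
    mod [k].  Replacing the smallest part [x] of a decreasing sequence of width
    less than [k] by the new largest part [x + k] keeps both the width condition
    and the residues, and adds [k] to the sum; so the sequences with a given
    nonempty residue set [S] form a chain above [S] itself, read as a sequence of
    numbers below [k].  The members with largest part at least [k] are those
    strictly above the bottom of the chain, hence the partitions of [n] in the
    statement correspond, with their length, to the nonempty sets [S] of residues
    whose sum is congruent to [n] mod [k] and less than [n].  Adding or removing
    the residue 0 changes the parity of [#|S|] and preserves the sum; only
    [S = {0}] is left unpaired, and it counts exactly when [k] divides [n]. *)
Require Import Defs.
From mathcomp Require Import all_boot all_order all_algebra.
From mathcomp Require Import zify.

Set Implicit Arguments.
Unset Strict Implicit.
Unset Printing Implicit Defensive.

(** * Narrow sequences and the moves along a chain *)

(** The additive form of the width bound avoids truncated subtraction. A last entry 0 is allowed, so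
    that the bottom of a chain may contain the residue 0. *)
Definition narrow (k : nat) (s : seq nat) : bool :=
  sorted gtn s && (head 0 s < k + last 0 s).

Definition residues (k : nat) (s : seq nat) : seq nat := [seq i %% k | i <- s].

Definition raise (k : nat) (s : seq nat) : seq nat :=
  if s is x :: t then last x t + k :: belast x t else [::].

Definition lower (k : nat) (s : seq nat) : seq nat :=
  if s is x :: t then rcons t (x - k) else [::].

Lemma raise_rcons k s x : raise k (rcons s x) = x + k :: s.
Proof. by case: s => //= y s; rewrite last_rcons belast_rcons. Qed.

Lemma sorted_gtn_rcons s x :
  sorted gtn (rcons s x) = sorted gtn s && ((s == [::]) || (x < last 0 s)).
Proof. by case: s => //= y s; rewrite rcons_path. Qed.

Lemma sorted_gtn_cons s x :
  sorted gtn (x :: s) = sorted gtn s && ((s == [::]) || (head 0 s < x)).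
Proof. by case: s => //= y s; rewrite andbC. Qed.

Lemma sorted_gtn_last_head s : sorted gtn s -> last 0 s <= head 0 s.
Proof.
elim: s => // x s IHs; rewrite sorted_gtn_cons => /andP[/IHs ls].
by case: s ls {IHs} => //= y s ls yx; apply: leq_trans ls (ltnW yx).
Qed.

(** The width bound on [s] puts the new head above the old one; strict decrease puts the new last
    entry above the one moved, which gives the new width bound. *)
Lemma narrow_raise k s : 0 < k -> narrow k s -> narrow k (raise k s).
Proof.
case/lastP: s => // s x k0; rewrite /narrow raise_rcons.
rewrite sorted_gtn_rcons sorted_gtn_cons last_rcons => /andP[/andP[-> sx]].
by case: s sx => [|y s] /= sx yx; lia.
Qed.

Lemma narrow_lower k s : k <= head 0 s -> narrow k s -> narrow k (lower k s).
Proof.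
case: s => // x s; rewrite /narrow /lower /=.
rewrite -/(sorted gtn (x :: s)) sorted_gtn_cons sorted_gtn_rcons last_rcons.
by move=> kx /andP[/andP[-> sx]]; case: s sx => [|y s] /= sx yx; lia.
Qed.

Lemma lowerK k s : k <= head 0 s -> raise k (lower k s) = s.
Proof. by case: s => //= x s kx; rewrite raise_rcons subnK. Qed.

Lemma sumn_raise k s : s != [::] -> sumn (raise k s) = sumn s + k.
Proof.
case/lastP: s => // s x _; rewrite raise_rcons sumn_rcons /=; lia.
Qed.

Lemma perm_residues_raise k s :
  perm_eq (residues k (raise k s)) (residues k s).
Proof.
case/lastP: s => // s x; rewrite raise_rcons /residues map_rcons /= modnDr.
by rewrite perm_sym perm_rcons.
Qed.

(** * Recovering a narrow sequence from its residues and its sum *)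

Lemma geq_trans : transitive geq.
Proof. by move=> y x z /= xy yz; exact: leq_trans yz xy. Qed.

Lemma perm_sort_geq s t : perm_eq s t -> sort geq s = sort geq t.
Proof.
move=> st; apply/perm_sortP => //; last 2 first.
- exact: geq_trans.
- by move=> x y; rewrite /= andbC -eqn_leq => /eqP.
by move=> x y; exact: leq_total.
Qed.

Lemma sumn_residues_leq k s : sumn (residues k s) <= sumn s.
Proof. by elim: s => //= x s IHs; rewrite leq_add ?leq_mod. Qed.

Lemma sumn_residues_modn k s : sumn (residues k s) = sumn s %[mod k].
Proof.
by elim: s => //= x s IHs; rewrite modnDml -modnDmr IHs modnDmr.
Qed.

(** Each entry is at least its residue, so equal sums leave no room for a strict inequality
    anywhere. *)
Lemma sumn_residues_eq k s : sumn s = sumn (residues k s) -> residues k s = s.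
Proof.
elim: s => //= x s IHs sE.
have := leq_mod x k; have := sumn_residues_leq k s => sl xl.
by rewrite IHs; [congr (_ :: _); lia | lia].
Qed.

Lemma residues_id k s : {in s, forall i, i < k} -> residues k s = s.
Proof.
move=> sk; rewrite /residues -[RHS]map_id; apply/eq_in_map => i /sk.
exact: modn_small.
Qed.

Lemma sorted_gtn_mem s i : sorted gtn s -> i \in s -> last 0 s <= i <= head 0 s.
Proof.
elim: s => // x s IHs xs; rewrite inE => /orP[/eqP->|i_s].
  by rewrite leqnn andbT; exact: sorted_gtn_last_head xs.
move: xs; rewrite sorted_gtn_cons => /andP[ss sx].
by have := IHs ss i_s; case: s sx i_s {IHs ss} => //= y s; lia.
Qed.

Lemma narrow_uniq_residues k s : narrow k s -> uniq (residues k s).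
Proof.
move=> /andP[ss ks]; rewrite map_inj_in_uniq; last first.
  move=> i j /(sorted_gtn_mem ss) /andP[li ih] /(sorted_gtn_mem ss) /andP[lj jh].
  move=> ijE; have iE := divn_eq i k; have jE := divn_eq j k.
  suff ab : i %/ k = j %/ k by rewrite iE jE ijE ab.
  rewrite ijE in iE; move: (i %/ k) (j %/ k) iE jE => a b iE jE.
  (* Congruent entries with different quotients would be at least [k] apart, exceeding the width. *)
  by have [ab|ba|//] := ltngtP a b; nia.
by move: ss; rewrite gtn_sorted_uniq_geq => /andP[].
Qed.

(** This gives injectivity of the correspondence: the residues fix the chain and the sum fixes the
    height [m] on it. The induction undoes one raise at a time. *)
Lemma narrow_iter_raise k m s :
    0 < k -> narrow k s -> sumn s = sumn (residues k s) + m * k ->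
  s = iter m (raise k) (sort geq (residues k s)).
Proof.
move=> k0; elim: m s => [|m IHm] s ns; rewrite ?mul0n ?addn0 => sE /=.
  rewrite (sumn_residues_eq sE) sorted_sort //; first exact: geq_trans.
  by case/andP: ns; rewrite gtn_sorted_uniq_geq => /andP[].
(* If all entries were below [k], then [s] would be its own residue sequence, contradicting the
   surplus [m.+1 * k]. *)
have [kh|hk] := leqP k (head 0 s); last first.
  have sk : residues k s = s.
    apply: residues_id => i; case/andP: ns => ss _.
    by move=> /(sorted_gtn_mem ss)/andP[_ /leq_ltn_trans]; apply.
  by rewrite sk mulSn in sE; lia.
have sl : lower k s != [::] by case: (s) kh => [|x []] //=; lia.
have pl : perm_eq (residues k s) (residues k (lower k s)).
  by rewrite -{1}(lowerK kh) perm_residues_raise.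
rewrite -{1}(lowerK kh); congr (raise k _).
rewrite {1}(IHm _ (narrow_lower kh ns)); last first.
  have := sumn_raise k sl; rewrite lowerK // -(perm_sumn pl); lia.
by rewrite (perm_sort_geq pl).
Qed.

(** * Sets of residues as bottoms of chains *)

Section ResidueSets.

Variables (n k : nat).

(** The modulus is a successor so that ['I_K] contains [ord0], the residue to be toggled. *)
Local Notation K := k.+1.

Definition residue_set (s : seq nat) : {set 'I_K} :=
  [set i : 'I_K | val i \in residues K s].

Definition decreasing_seq (S : {set 'I_K}) : seq nat :=
  sort geq [seq val i | i <- enum S].

Lemma perm_decreasing_seq S :
  perm_eq (decreasing_seq S) [seq val i | i <- enum S].
Proof. by rewrite perm_sort. Qed.

Lemma mem_decreasing_seq S (i : 'I_K) : (val i \in decreasing_seq S) = (i \in S).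
Proof.
by rewrite (perm_mem (perm_decreasing_seq S)) (mem_map val_inj) mem_enum.
Qed.

Lemma decreasing_seq_lt S i : i \in decreasing_seq S -> i < K.
Proof.
rewrite (perm_mem (perm_decreasing_seq S)) => /mapP[j _ ->]; exact: ltn_ord.
Qed.

Lemma sumn_decreasing_seq S : sumn (decreasing_seq S) = \sum_(i in S) i.
Proof.
by rewrite (perm_sumn (perm_decreasing_seq S)) sumnE big_map big_enum.
Qed.

Lemma size_decreasing_seq S : size (decreasing_seq S) = #|S|.
Proof. by rewrite size_sort size_map cardE. Qed.

Lemma narrow_decreasing_seq S : narrow K (decreasing_seq S).
Proof.
apply/andP; split.
  rewrite gtn_sorted_uniq_geq sort_uniq (map_inj_uniq val_inj) enum_uniq.
  by apply: sort_sorted => x y; exact: leq_total.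
have := @decreasing_seq_lt S; case: (decreasing_seq S) => //= x s sK.
by have := sK x (mem_head x s); lia.
Qed.

Lemma perm_residues s :
  narrow K s -> perm_eq (residues K s) (decreasing_seq (residue_set s)).
Proof.
move=> ns; rewrite perm_sym (perm_trans (perm_decreasing_seq _)) //.
apply: uniq_perm; rewrite ?(map_inj_uniq val_inj) ?enum_uniq //.
  exact: narrow_uniq_residues.
move=> i; apply/mapP/idP => [[j]|/[dup] iR /mapP[j _ iE]].
  by rewrite mem_enum inE => jR ->.
have iK : i < K by rewrite iE ltn_mod.
by exists (Ordinal iK); rewrite ?mem_enum ?inE.
Qed.

(** This gives surjectivity. The first three properties persist through every raise; the last two
    need at least one raise, hence [m.+1]. *)
Lemma iter_raiseP S m (s := iter m.+1 (raise K) (decreasing_seq S)) :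
    S != set0 ->
  [/\ narrow K s, perm_eq (residues K s) (decreasing_seq S),
      sumn s = \sum_(i in S) i + m.+1 * K, K <= head 0 s & 0 < last 0 s].
Proof.
move=> S0; pose t := iter m (raise K) (decreasing_seq S).
have [nt pt tE] : [/\ narrow K t, perm_eq (residues K t) (decreasing_seq S)
    & sumn t = \sum_(i in S) i + m * K].
  rewrite {}/t {}/s; elim: m => [|m [nt pt tE]] /=.
    rewrite narrow_decreasing_seq sumn_decreasing_seq mul0n addn0.
    by rewrite residues_id // => i /decreasing_seq_lt.
  split; first exact: narrow_raise.
    exact: perm_trans (perm_residues_raise _ _) pt.
  rewrite sumn_raise ?tE; first by rewrite mulSnr addnA.
  rewrite -size_eq0 -(size_map (modn^~ K)) (perm_size pt) size_decreasing_seq.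
  by rewrite cards_eq0.
have t0 : t != [::].
  rewrite -size_eq0 -(size_map (modn^~ K)) (perm_size pt) size_decreasing_seq.
  by rewrite cards_eq0.
have -> : s = raise K t by [].
split; first exact: narrow_raise.
- exact: perm_trans (perm_residues_raise _ _) pt.
- by rewrite sumn_raise // tE mulSnr addnA.
- by case/lastP: (t) t0 => // r x _; rewrite raise_rcons leq_addl.
(* The entry [x] sent to the front was strictly the smallest, so whatever is now last is positive
   even if [x] is 0; a singleton becomes [x + K]. *)
- move: nt t0; case/lastP: (t) => // r x /andP[+ _] _.
  rewrite raise_rcons sorted_gtn_rcons => /andP[_].
  by case: r => /= [_|y r]; lia.
Qed.

(** * The bijection from partitions to residue sets *)

Definition narrow_partitions (b : bool) : {set 'SP(n)} :=
  [set la : 'SP(n) |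
    largest_part la - smallest_part la < K <= largest_part la
    & odd (\ell la) == b].

(** The strict bound by [n] excludes the bottom of the chain, whose entries are all below [K]. *)
Definition low_residue_sets (b : bool) : {set {set 'I_K}} :=
  [set S : {set 'I_K} | [&& S != set0, \sum_(i in S) i < n,
    \sum_(i in S) i == n %[mod K] & odd #|S| == b]].

Lemma strict_partitionP (s : seq nat) :
  reflect [/\ sorted gtn s, 0 \notin s & sumn s = n] (is_strict_partition n s).
Proof.
apply: (iffP andP) => [[/and3P[_ ? /eqP ?] ?] | [ss s0 /eqP sE]] //.
split=> //; rewrite /is_partition s0 sE !andbT.
by move: ss; rewrite gtn_sorted_uniq_geq => /andP[].
Qed.

Lemma narrow_partition_narrow b la : la \in narrow_partitions b -> narrow K la.
Proof.
rewrite inE => /andP[/andP[w _] _].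
have /strict_partitionP[ss _ _] := valP la.
by rewrite /narrow ss /=; move: w; rewrite /largest_part /smallest_part; lia.
Qed.

Lemma card_narrow_partitions b : #|narrow_partitions b| = #|low_residue_sets b|.
Proof.
have sumR la : la \in narrow_partitions b ->
    \sum_(i in residue_set la) i = sumn (residues K la).
  move=> /narrow_partition_narrow/perm_residues/perm_sumn ->.
  by rewrite sumn_decreasing_seq.
rewrite -(card_in_imset (f := fun la : strict_partition n => residue_set la)); last first.
  move=> la mu laA muA RE.
  have := narrow_partition_narrow laA; have := narrow_partition_narrow muA.
  have /strict_partitionP[_ _ laE] := valP la.
  have /strict_partitionP[_ _ muE] := valP mu.
  move=> nmu nla; apply: val_inj => /=.
  have pr : perm_eq (residues K la) (residues K mu).
    by rewrite (perm_trans (perm_residues nla)) // RE perm_sym perm_residues.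
  (* Both partitions have sum [n] and the same residues up to order, so a single height [m] serves
     for both. *)
  have [m nE] : exists m, n = sumn (residues K la) + m * K.
    exists ((n - sumn (residues K la)) %/ K).
    have := sumn_residues_leq K la; rewrite laE => le_n.
    rewrite divnK ?subnKC // -eqn_mod_dvd // -[in X in X == _]laE.
    by rewrite sumn_residues_modn.
  rewrite (@narrow_iter_raise K m la) // ?laE //.
  rewrite (@narrow_iter_raise K m mu) // ?muE -?(perm_sumn pr) //.
  by rewrite (perm_sort_geq pr).
apply: eq_card => S; apply/imsetP/idP => [[la laA ->]|].
  have nla := narrow_partition_narrow laA.
  have /strict_partitionP[_ _ laE] := valP la.
  have szR : #|residue_set la| = size la.
    by rewrite -size_decreasing_seq -(perm_size (perm_residues nla)) size_map.
  rewrite inE (sumR _ laA) sumn_residues_modn laE eqxx szR.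
  have := laA; rewrite inE => /andP[/andP[_ Kla] ->]; rewrite andbT.
  apply/andP; split.
    rewrite -cards_eq0 szR; case: (parts la) Kla => //.
  (* Equality would make [la] its own residue sequence, against a largest part of at least [K]. *)
  have := sumn_residues_leq K la; rewrite laE leq_eqVlt => /orP[/eqP sE|-> //].
  move: Kla; rewrite -(@sumn_residues_eq K la) ?laE // /largest_part.
  by case: (parts la) => //= x s; rewrite leqNgt ltn_mod.
rewrite inE => /and4P[S0 Sn Sm Sb].
(* The gap to [n] is a positive multiple of [K], so the quotient is a successor, as [iter_raiseP]
   requires. *)
pose m := ((n - \sum_(i in S) i) %/ K).-1.
have mE : n = \sum_(i in S) i + m.+1 * K.
  have dv : K %| n - \sum_(i in S) i by rewrite -eqn_mod_dvd 1?ltnW // eq_sym.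
  rewrite prednK; first by rewrite divnK // subnKC // ltnW.
  by rewrite divn_gt0 // dvdn_leq // subn_gt0.
have [] := iter_raiseP m S0; set s := iter _ _ _.
move=> ns ps sE Ks s0.
have /andP[ss sw] := ns.
have sP : is_strict_partition n s.
  apply/strict_partitionP; split; rewrite ?sE //.
  by apply/negP => /(sorted_gtn_mem ss); lia.
exists (StrictPartition sP); last first.
  by apply/setP => i; rewrite inE /= (perm_mem ps) mem_decreasing_seq.
rewrite inE /= /largest_part /smallest_part Ks andbT.
rewrite -(size_map (modn^~ K) s) (perm_size ps) size_decreasing_seq Sb andbT.
lia.
Qed.

(** * The parity-reversing involution *)

Definition toggle0 (S : {set 'I_K}) : {set 'I_K} :=
  if ord0 \in S then S :\ ord0 else ord0 |: S.

Lemma toggle0K : involutive toggle0.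
Proof.
move=> S; rewrite /toggle0; have [S0|S0] := boolP (ord0 \in S).
  by rewrite setD11 setD1K.
by rewrite setU11 setU1K.
Qed.

Lemma sum_toggle0 S : \sum_(i in toggle0 S) i = \sum_(i in S) i.
Proof.
rewrite /toggle0; case: ifPn => S0; last by rewrite big_setU1.
by rewrite [RHS](big_setD1 ord0).
Qed.

Lemma odd_card_toggle0 S : odd #|toggle0 S| = ~~ odd #|S|.
Proof.
rewrite /toggle0; case: ifPn => S0; last by rewrite cardsU1 S0.
by rewrite [in RHS](cardsD1 ord0) S0 /= negbK.
Qed.

Lemma toggle0_eq0 S : (toggle0 S == set0) = (S == [set ord0]).
Proof.
have <- : toggle0 set0 = [set ord0] by rewrite /toggle0 inE setU0.
by rewrite -(can2_eq toggle0K toggle0K).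
Qed.

Lemma card_low_residue_sets :
  0 < n -> #|low_residue_sets true| = (K %| n) + #|low_residue_sets false|.
Proof.
(* The set [[set ord0]] is split off: it has odd size and sum 0, so it belongs exactly when [K]
   divides [n]. *)
move=> n_gt0; rewrite (cardsD1 [set ord0]); congr (nat_of_bool _ + _).
  rewrite inE big_set1 cards1 n_gt0 -cards_eq0 cards1 mod0n /=.
  by rewrite andbT eq_sym.
(* The remaining odd sets are exactly the preimage of the even ones under [toggle0]; the empty set
   drops out of that preimage by parity. *)
rewrite -[RHS](card_preimset _ (inv_inj toggle0K)); apply: eq_card => S.
rewrite !inE sum_toggle0 odd_card_toggle0 toggle0_eq0.
have [->|_] /= := eqVneq S set0; first by rewrite cards0 !andbF.
have [->|_] /= := eqVneq S [set ord0]; first by [].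
by case: odd.
Qed.

End ResidueSets.

Theorem theorem3p2 (n k : nat) (n_gt0 : 0 < n) (k_gt0 : 0 < k) :
  (#|[set la : 'SP(n) |
        largest_part la - smallest_part la < k <= largest_part la
        & odd (\ell la)]|%N%:Z
   - #|[set la : 'SP(n) |
        largest_part la - smallest_part la < k <= largest_part la
        & ~~ odd (\ell la)]|%N%:Z
   = if (k %| n)%N then 1 else 0)%R.
Proof.
case: k k_gt0 => // k _.
have := card_low_residue_sets k n_gt0; rewrite -!card_narrow_partitions.
rewrite /narrow_partitions.
under eq_finset => la do rewrite eqb_id.
under [in X in _ = _ + X]eq_finset => la do rewrite eqbF_neg.
by move=> ->; rewrite PoszD GRing.addrK; case: (_ %| n).
Qed.
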